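(* Let $J \in \mathrm{GL}_n(\mathbb{C})$, $G = \{M \in \mathrm{GL}_n(\mathbb{C}) : MJM^* = J\}$ and $\mathfrak{g} = \{\Omega\in\mathbb{C}^{n\times n} : \Omega J + J\Omega^* = 0\}$. Let $A(\cdot)$ take values in $\mathfrak{g}$ and admit an expansion in powers of $t$, $A(t) = \sum_{m\ge1} a_m t^{m-1}$, near $t=0$, and let $Y$ be the solution of $\dot Y(t) = A(t)Y(t)$, $Y(0) = Y_0 \in G$. For a time-step $\delta t > 0$ set $$A^1 = A\Big(\big(\tfrac12 - \tfrac{\sqrt3}{6}\big)\delta t\Big),\quad A^2 = A\Big(\big(\tfrac12 + \tfrac{\sqrt3}{6}\big)\delta t\Big),$$ $$A_1(\delta t) = \tfrac{\delta t}{2}(A^1 + A^2),\quad A_2(\delta t) = \tfrac{\sqrt3\,\delta t}{2}(A^2 - A^1),$$ and let $$\alpha_{11} = \frac{2^{1/3}}{3} + \frac{2^{2/3}}{6} + \frac23,\quad \alpha_{21} = 1 - 2\alpha_{11},\quad \alpha_{12} = \alpha_{11} - \alpha_{11}^2.$$ Then, as $\delta t \to 0$, $$Y(\delta t) = \mathrm{Cay}\big(\alpha_{11}A_1(\delta t) + \alpha_{12}A_2(\delta t)\big)\,\mathrm{Cay}\big(\alpha_{21}A_1(\delta t)\big)\,\mathrm{Cay}\big(\alpha_{11}A_1(\delta t) - \alpha_{12}A_2(\delta t)\big)Y_0 + O(\delta t^5).$$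
   Context: For $M \in \mathbb{C}^{n\times n}$, $M^*$ denotes the conjugate transpose. The Cayley transform of $\Omega\in\mathbb{C}^{n\times n}$ with $2\notin\sigma(\Omega)$ (where $\sigma$ denotes the spectrum) is $\mathrm{Cay}(\Omega) = (I - \tfrac12\Omega)^{-1}(I + \tfrac12\Omega)$; the Cayley transforms in the claim are defined for all sufficiently small $\delta t$. The set $\mathfrak{g}$ is the Lie algebra of $G$. *)

(* Defs.v *)
From HB Require Import structures.
From mathcomp Require Import all_boot all_order all_algebra complex.
From mathcomp Require Import all_classical all_reals all_analysis.

Set Implicit Arguments.
Unset Strict Implicit.
Unset Printing Implicit Defensive.

Import Order.TTheory GRing.Theory Num.Theory numFieldNormedType.Exports.

Local Open Scope classical_set_scope.
Local Open Scope ring_scope.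
Local Open Scope complex_scope.
Local Open Scope sesquilinear_scope.

(* [R[i]] with the topology of its modulus, as [numFieldNormedType] does for
   the abstract number fields. *)
HB.instance Definition _ (R : realType) := NormedModule.copy R[i] R[i]^o.

Section QuadraticGroup.
Variables (R : realType) (n : nat).
Implicit Types J M Omega : 'M[R[i]]_n.

Definition quadratic_group J : set 'M[R[i]]_n :=
  [set M | M \in unitmx /\ M *m J *m M ^t* = J].

Definition quadratic_algebra J : set 'M[R[i]]_n :=
  [set Omega | Omega *m J + J *m Omega ^t* = 0].

(* [invmx] is total: this is the Cayley transform only when [2] is not an
   eigenvalue of [Omega], i.e. under [cayley_defined Omega]. *)
Definition cayley Omega : 'M[R[i]]_n :=
  invmx (1%:M - 2^-1 *: Omega) *m (1%:M + 2^-1 *: Omega).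

Definition cayley_defined Omega : Prop := ~~ eigenvalue Omega 2.

(* [Y] has derivative [l] at [t] relative to [D], for a real variable:
   [derive] does not apply, matrices over [R[i]] being normed over [R[i]]
   only. At an end point of an interval [D] the derivative is one-sided. *)
Definition has_derivative_within (D : set R) (Y : R -> 'M[R[i]]_n) (t : R)
    (l : 'M[R[i]]_n) : Prop :=
  ((s - t)^-1)%:C *: (Y s - Y t) @[s --> within D t^'] --> l.

End QuadraticGroup.

Section Coefficients.
Variables (R : realType) (n : nat) (A : R -> 'M[R[i]]_n).

(* [A] at the two Gauss-Legendre nodes of the step [0, dt] *)
Definition gauss_node1 (dt : R) : 'M[R[i]]_n :=
  A ((1 / 2 - Num.sqrt 3 / 6) * dt).

Definition gauss_node2 (dt : R) : 'M[R[i]]_n :=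
  A ((1 / 2 + Num.sqrt 3 / 6) * dt).

Definition magnus1 (dt : R) : 'M[R[i]]_n :=
  (dt / 2)%:C *: (gauss_node1 dt + gauss_node2 dt).

Definition magnus2 (dt : R) : 'M[R[i]]_n :=
  (Num.sqrt 3 * dt / 2)%:C *: (gauss_node2 dt - gauss_node1 dt).

End Coefficients.

Definition alpha11 (R : realType) : R :=
  2 `^ (1 / 3) / 3 + 2 `^ (2 / 3) / 6 + 2 / 3.

Definition alpha21 (R : realType) : R := 1 - 2 * alpha11 R.

Definition alpha12 (R : realType) : R := alpha11 R - alpha11 R ^+ 2.

Section Scheme.
Variables (R : realType) (n : nat) (A : R -> 'M[R[i]]_n) (dt : R).

Definition exponent_left : 'M[R[i]]_n :=
  (alpha11 R)%:C *: magnus1 A dt + (alpha12 R)%:C *: magnus2 A dt.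

Definition exponent_middle : 'M[R[i]]_n := (alpha21 R)%:C *: magnus1 A dt.

Definition exponent_right : 'M[R[i]]_n :=
  (alpha11 R)%:C *: magnus1 A dt - (alpha12 R)%:C *: magnus2 A dt.

End Scheme.

(* Main.v *)
Require Import Defs.
From mathcomp Require Import all_boot all_order all_algebra complex.
From mathcomp Require Import all_classical all_reals all_analysis.
From mathcomp Require Import ring lra zify.
Import Order.TTheory GRing.Theory Num.Theory numFieldNormedType.Exports.

Local Open Scope classical_set_scope.
Local Open Scope ring_scope.
Local Open Scope complex_scope.

Set Implicit Arguments.
Unset Strict Implicit.
Unset Printing Implicit Defensive.

(** Both sides of the claim have an expansion in powers of the step [h], and
    the point is to compare the coefficients of [h ^ 0], ..., [h ^ 4].

    Write [b j] for the coefficient of [t ^ j] in [A]. The exponents of the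
    three Cayley transforms are [h B(h)] where [B(h)] is a linear combination
    of [A(c1 h)] and [A(c2 h)], hence has an expansion with coefficients
    [u j * b j] for real numbers [u j]. Two fixed-point equations produce the
    expansions:
    - [Y(h) = Y(0) + int_0^h A Y] turns an expansion of [A Y] to order [N] into
      one of [Y] to order [N + 1] ([integral_expansion], [flow_expansion]);
    - [Z = Cay(h B) F] satisfies [Z = F + h B (F + Z) / 2], so an expansion of
      [Z] to order [N] gives one to order [N + 1] ([cayley_expansion]).
    Starting from mere boundedness, the expansions of all orders follow by
    induction.

    Because each equation only multiplies by some [b j] on the left, the [k]-th
    coefficient of either side is a sum over words [w = j1 ... jr] of weight
    [(j1 + 1) + ... + (jr + 1) = k] of a real number times
    [b j1 * ... * b jr * Y0] ([word_sum]). The real numbers obey recursions on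
    the word ([flow_word], [cayley_word]), and it suffices that they agree for
    the sixteen words of weight at most 4 ([order_conditions]).

    Those sixteen identities are rational consequences of the moments of the
    Gauss-Legendre nodes ([node_meanE], [node_slopeE]), of the relations
    defining [alpha21] and [alpha12] from [x = alpha11], and of one cubic
    equation [x (1 - x) ^ 2 = 1 / 6] ([alpha11_cubic]). The latter is the same
    as [2 x ^ 3 + (1 - 2 x) ^ 3 = 0]: since Cay(Omega) is the exponential of
    [Omega + Omega ^ 3 / 12 + ...], it cancels the cubic defects of the three
    factors, and at the same time it gives the commutator of the two moments
    the weight [- 1 / 6] that it has in the Magnus expansion. *)

(** * A real-valued norm on complex matrices *)

Section RealNorm.
Variable R : realType.

Lemma norm_real_complex (x : R) : `|x%:C| = `|x|%:C :> R[i].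
Proof. by rewrite normc_def /= expr0n addr0 sqrtr_sqr. Qed.

Lemma normc_ge_Im (x : R[i]) : `|complex.Im x|%:C <= `|x|.
Proof.
have := normc_ge_Re (x * 'i); rewrite ReiNIm normrN normrM.
by rewrite [`|'i|]normc_def /= expr0n expr1n add0r sqrtr1 mulr1.
Qed.

Lemma normc_le_Re_Im (x : R[i]) :
  `|x| <= (`|complex.Re x| + `|complex.Im x|)%:C.
Proof.
rewrite {1}[x]complexE rmorphD /= -!norm_real_complex.
apply: le_trans (ler_normD _ _) _; rewrite lerD2l normrM.
by rewrite [`|'i|]normc_def /= expr0n expr1n add0r sqrtr1 mul1r.
Qed.

(** The norm of a complex matrix is an element of [R[i]], where the order is
    only partial; its real part carries the same information and can be
    compared in [R]. *)
Definition mnorm m n (M : 'M[R[i]]_(m, n)) : R := complex.Re `|M|.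

Lemma mnormE m n (M : 'M[R[i]]_(m, n)) : (mnorm M)%:C = `|M|.
Proof.
rewrite /mnorm; have := normr_ge0 M; move: `|M| => [x y].
by rewrite lecE /= => /andP[/eqP -> _].
Qed.

Lemma mnorm_ge0 m n (M : 'M[R[i]]_(m, n)) : 0 <= mnorm M.
Proof. by rewrite -lecR mnormE (normr_ge0 M). Qed.

Lemma mnorm0 m n : mnorm (0 : 'M[R[i]]_(m, n)) = 0.
Proof. by apply: complexI; rewrite mnormE normr0. Qed.

Lemma mnorm_eq0 m n (M : 'M[R[i]]_(m, n)) : mnorm M = 0 -> M = 0.
Proof. by move=> M0; apply/eqP; rewrite -normr_eq0 -mnormE M0. Qed.

Lemma mnormN m n (M : 'M[R[i]]_(m, n)) : mnorm (- M) = mnorm M.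
Proof. by rewrite /mnorm normrN. Qed.

Lemma mnormD m n (M N : 'M[R[i]]_(m, n)) : mnorm (M + N) <= mnorm M + mnorm N.
Proof. by rewrite -lecR rmorphD /= !mnormE ler_normD. Qed.

Lemma mnormZ m n (c : R) (M : 'M[R[i]]_(m, n)) :
  mnorm (c%:C *: M) = `|c| * mnorm M.
Proof.
by apply: complexI; rewrite rmorphM /= !mnormE normrZ norm_real_complex.
Qed.

Lemma norm_entry m n (M : 'M[R[i]]_(m, n)) i j : `|M i j| <= `|M|.
Proof.
rewrite [leRHS]/Num.Def.normr /= mx_normE -[leLHS]nngE num_le.
exact: (le_bigmax _ (fun ij : 'I_m * 'I_n => `|M ij.1 ij.2|%:nng) (i, j)).
Qed.

Lemma mnorm_entry m n (M : 'M[R[i]]_(m, n)) i j : `|M i j| <= (mnorm M)%:C.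
Proof. by rewrite mnormE norm_entry. Qed.

Lemma mnorm_le m n (M : 'M[R[i]]_(m, n)) (K : R) : 0 <= K ->
  (forall i j, `|M i j| <= K%:C) -> mnorm M <= K.
Proof.
move=> K0 leK; rewrite -lecR mnormE.
have [|M0] := eqVneq (mx_norm M) 0.
  by rewrite [`|M|]/Num.Def.normr /= => ->; rewrite lecR.
have [[i j] /= Mij] := mx_norm_neq0 M0.
by rewrite [`|M|]/Num.Def.normr /= Mij.
Qed.

(** The norm is the maximum of the moduli of the entries, which is
    submultiplicative only up to the inner dimension. *)
Lemma mnormM m n p (M : 'M[R[i]]_(m, n)) (N : 'M[R[i]]_(n, p)) :
  mnorm (M *m N) <= n%:R * (mnorm M * mnorm N).
Proof.
apply: mnorm_le => [|i j]; first by rewrite !mulr_ge0 ?mnorm_ge0.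
rewrite mxE; apply: le_trans (ler_norm_sum _ _ _) _.
rewrite -[n in n%:R]card_ord mulr_natl rmorphMn /= -sumr_const.
by apply: ler_sum => k _; rewrite normrM rmorphM ler_pM ?mnorm_entry.
Qed.

Lemma cvg_mnorm (T : Type) (F : set_system T) {FF : Filter F} m n
    (f : T -> 'M[R[i]]_(m, n)) (l : 'M[R[i]]_(m, n)) (e : R) :
  f @ F --> l -> 0 < e -> \forall x \near F, mnorm (l - f x) < e.
Proof.
move=> /cvgrPdist_lt fl e0.
have := fl e%:C; rewrite ltcR => /(_ e0).
by apply: filterS => x; rewrite -mnormE ltcR.
Qed.

End RealNorm.

(** * Expansions at the right of 0 *)

Section Order.
Variable R : realType.

(** A concrete radius is easier to transport along [h |-> c * h] than the
    filter. *)
Lemma near_right0P (P : R -> Prop) :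
  (\forall h \near 0^'+, P h) <->
  exists2 d : R, 0 < d & forall h, 0 < h -> h < d -> P h.
Proof.
split=> [[d /= d0 dP]|[d d0 dP]].
  exists d => // h h0 hd; apply: dP => //=.
  by rewrite sub0r normrN gtr0_norm.
near=> h; apply: dP; near: h; [exact: nbhs_right_gt | exact: nbhs_right_lt].
Unshelve. all: by end_near. Qed.

Variables m n : nat.
Implicit Types (F G : R -> 'M[R[i]]_(m, n)) (f g : nat -> 'M[R[i]]_(m, n)).

Definition is_bigO N F : Prop :=
  exists C : R, \forall h \near 0^'+, mnorm (F h) <= C * h ^+ N.

Lemma is_bigO_near N F G : (\forall h \near 0^'+, F h = G h) ->
  is_bigO N F -> is_bigO N G.
Proof.
move=> FG [C FC]; exists C; near=> h.
have <- : F h = G h by near: h.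
by near: h.
Unshelve. all: by end_near. Qed.

Lemma is_bigO0 N : is_bigO N (fun=> 0).
Proof. by exists 0; apply: nearW => h; rewrite mnorm0 mul0r. Qed.

Lemma is_bigOD N F G : is_bigO N F -> is_bigO N G ->
  is_bigO N (fun h => F h + G h).
Proof.
move=> [C FC] [D GD]; exists (C + D); near=> h.
rewrite mulrDl; apply: le_trans (mnormD _ _) _.
by apply: lerD; near: h.
Unshelve. all: by end_near. Qed.

Lemma is_bigOZ N (c : R) F : is_bigO N F -> is_bigO N (fun h => c%:C *: F h).
Proof.
move=> [C FC]; exists (`|c| * C); near=> h.
rewrite mnormZ -mulrA; apply: ler_wpM2l => //.
by near: h.
Unshelve. all: by end_near. Qed.

(** Each use of a fixed-point equation gains one order through this factor
    [h]. *)
Lemma is_bigO_step N F : is_bigO N F -> is_bigO N.+1 (fun h => h%:C *: F h).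
Proof.
move=> [C FC]; exists C; near=> h.
have h0 : 0 < h by near: h; exact: nbhs_right_gt.
rewrite mnormZ gtr0_norm// exprS mulrCA ler_pM2l//.
by near: h.
Unshelve. all: by end_near. Qed.

Lemma is_bigO_monomial N (M : 'M[R[i]]_(m, n)) :
  is_bigO N (fun h => (h ^+ N)%:C *: M).
Proof.
exists (mnorm M); near=> h.
have h0 : 0 < h by near: h; exact: nbhs_right_gt.
by rewrite mnormZ gtr0_norm ?exprn_gt0// mulrC.
Unshelve. all: by end_near. Qed.

(** For [h <= 1] the higher power is the smaller one; [C] may be negative, so
    the constant has to be replaced by its absolute value. *)
Lemma is_bigOW N F : is_bigO N.+1 F -> is_bigO N F.
Proof.
move=> [C FC]; exists `|C|; near=> h.
have h0 : 0 < h by near: h; exact: nbhs_right_gt.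
have h1 : h <= 1 by near: h; exact: nbhs_right_le.
have hN : 0 <= h ^+ N by rewrite exprn_ge0 ?ltW.
apply: (@le_trans _ _ (C * h ^+ N.+1)); first by near: h.
apply: (@le_trans _ _ (`|C| * h ^+ N.+1)).
  by rewrite ler_wpM2r ?ler_norm// exprS mulr_ge0// ltW.
by rewrite ler_wpM2l// exprS ler_piMl.
Unshelve. all: by end_near. Qed.

End Order.

Section Product.
Variables (R : realType) (m n p : nat).

Lemma is_bigO_mul N K (F : R -> 'M[R[i]]_(m, n)) (G : R -> 'M[R[i]]_(n, p)) :
  is_bigO N F -> is_bigO K G -> is_bigO (N + K) (fun h => F h *m G h).
Proof.
move=> [C FC] [D GD]; exists (n%:R * (C * D)); near=> h.
apply: le_trans (mnormM _ _) _.
rewrite -mulrA ler_wpM2l// exprD mulrACA.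
by apply: ler_pM; rewrite ?mnorm_ge0//; near: h.
Unshelve. all: by end_near. Qed.

End Product.

Section Expansion.
Variables (R : realType) (m n : nat).
Implicit Types (F G : R -> 'M[R[i]]_(m, n)) (f g : nat -> 'M[R[i]]_(m, n)).

Definition expansion N F f : Prop :=
  is_bigO N (fun h => F h - \sum_(k < N) (h ^+ k)%:C *: f k).

Lemma expansion0 F f : expansion 0 F f <-> is_bigO 0 F.
Proof.
by split; apply: is_bigO_near; apply: nearW => h; rewrite big_ord0 subr0.
Qed.

Lemma expansion_near N F G f : (\forall h \near 0^'+, F h = G h) ->
  expansion N F f -> expansion N G f.
Proof.
move=> FG; apply: is_bigO_near; near=> h.
by congr (_ - _); near: h.
Unshelve. all: by end_near. Qed.

Lemma eq_expansion N F f g : (forall k, (k < N)%N -> f k = g k) ->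
  expansion N F f -> expansion N F g.
Proof.
move=> fg; apply: is_bigO_near; apply: nearW => h; congr (_ - _).
by apply: eq_bigr => k _; rewrite fg.
Qed.

Lemma expansionD N F G f g : expansion N F f -> expansion N G g ->
  expansion N (fun h => F h + G h) (fun k => f k + g k).
Proof.
move=> Ff Gg; apply: is_bigO_near (is_bigOD Ff Gg); apply: nearW => h.
rewrite addrACA -opprD -big_split; congr (_ - _).
by apply: eq_bigr => k _; rewrite /= scalerDr.
Qed.

Lemma expansionZ N (c : R) F f : expansion N F f ->
  expansion N (fun h => c%:C *: F h) (fun k => c%:C *: f k).
Proof.
move=> Ff; apply: is_bigO_near (is_bigOZ c Ff); apply: nearW => h.
rewrite scalerBr scaler_sumr; congr (_ - _).
by apply: eq_bigr => k _; rewrite !scalerA mulrC.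
Qed.

(** Adding a constant to [h F(h)] shifts the coefficients by one place; both
    fixed-point equations have this form. *)
Lemma expansion_step N F f (M : 'M[R[i]]_(m, n)) : expansion N F f ->
  expansion N.+1 (fun h => M + h%:C *: F h)
    (fun k => if k is k'.+1 then f k' else M).
Proof.
move=> Ff; apply: is_bigO_near (is_bigO_step Ff); apply: nearW => h.
rewrite big_ord_recl expr0 scale1r opprD addrACA subrr add0r.
rewrite scalerBr scaler_sumr; congr (_ - _); apply: eq_bigr => k _.
by rewrite scalerA -rmorphM -exprS.
Qed.

Lemma expansionW N F f : expansion N.+1 F f -> expansion N F f.
Proof.
move=> /is_bigOW Ff.
apply: is_bigO_near (is_bigOD Ff (is_bigO_monomial N (f N))).
by apply: nearW => h; rewrite big_ord_recr /= opprD addrA subrK.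
Qed.

Lemma expansion_sub N F G f : expansion N F f -> expansion N G f ->
  is_bigO N (fun h => F h - G h).
Proof.
move=> Ff /(is_bigOZ (-1)) Gf; apply: is_bigO_near (is_bigOD Ff Gf).
by apply: nearW => h; rewrite rmorphN1 scaleN1r opprB addrA subrK.
Qed.

(** The converse of [expansion_step], used to peel off the constant term in
    inductions on the order. *)
Lemma expansion_tail N F f : expansion N.+1 F f ->
  expansion N (fun h => (h^-1)%:C *: (F h - f 0%N)) (fun k => f k.+1).
Proof.
move=> [C FC]; exists C; near=> h.
have h0 : 0 < h by near: h; exact: nbhs_right_gt.
have -> : (h^-1)%:C *: (F h - f 0%N) - \sum_(k < N) (h ^+ k)%:C *: f k.+1 =
          (h^-1)%:C *: (F h - \sum_(k < N.+1) (h ^+ k)%:C *: f k).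
  rewrite big_ord_recl expr0 scale1r opprD addrA [RHS]scalerBr; congr (_ - _).
  rewrite scaler_sumr; apply: eq_bigr => k _.
  by rewrite scalerA -rmorphM /= exprS mulKf ?gt_eqF.
rewrite mnormZ gtr0_norm ?invr_gt0// ler_pdivrMl// mulrCA -exprS.
by near: h.
Unshelve. all: by end_near. Qed.

(** Evaluation at a node [c * h] of the time step. *)
Lemma expansion_rescale N F f (c : R) : 0 < c -> expansion N F f ->
  expansion N (fun h => F (c * h)) (fun k => (c ^+ k)%:C *: f k).
Proof.
move=> c0 [C FC]; exists (C * c ^+ N).
have [d d0 dP] := (near_right0P _).1 FC.
apply/near_right0P; exists (d / c); first by rewrite divr_gt0.
move=> h h0 hd; rewrite -mulrA -exprMn.
have := dP (c * h); rewrite mulr_gt0// => /(_ isT).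
rewrite mulrC -ltr_pdivlMr// => /(_ hd); rewrite [h * c]mulrC.
congr (mnorm (_ - _) <= _); apply: eq_bigr => k _.
by rewrite scalerA -rmorphM /= exprMn mulrC.
Qed.

End Expansion.

Section CauchyProduct.
Variables (R : realType) (m n p : nat).

(** Cauchy product, by induction on the order: with [F = f 0 + h F'], the
    product [f 0 * G] needs no expansion of [F], and [F' * G] is only needed to
    one order less. *)
Lemma expansion_mulmx N (F : R -> 'M[R[i]]_(m, n)) (G : R -> 'M[R[i]]_(n, p))
    f g :
  expansion N F f -> expansion N G g ->
  expansion N (fun h => F h *m G h)
    (fun k => \sum_(j < k.+1) f j *m g (k - j)%N).
Proof.
elim: N F f => [|N IH] F f Ff Gg.
  apply/expansion0; rewrite -[0%N]/(0 + 0)%N.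
  by apply: is_bigO_mul; [move/expansion0: Ff | move/expansion0: Gg].
have fGg : expansion N.+1 (fun h => f 0%N *m G h) (fun k => f 0%N *m g k).
  have f0 : is_bigO 0 (fun=> f 0%N).
    apply: is_bigO_near (is_bigO_monomial 0 (f 0%N)).
    by apply: nearW => h; rewrite expr0 scale1r.
  apply: is_bigO_near (is_bigO_mul f0 Gg); apply: nearW => h.
  rewrite mulmxBr mulmx_sumr; congr (_ - _).
  by apply: eq_bigr => k _; rewrite scalemxAr.
have := IH _ _ (expansion_tail Ff) (expansionW Gg).
move=> /(expansion_step 0) /(expansionD fGg) E.
apply: (eq_expansion _ (expansion_near _ E)).
  case=> [_|k kN] /=; first by rewrite big_ord1 addr0.
  by rewrite [RHS]big_ord_recl subn0.
near=> h.
have h0 : 0 < h by near: h; exact: nbhs_right_gt.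
rewrite add0r -scalemxAl scalerA -rmorphM /= mulfV ?gt_eqF// scale1r.
by rewrite mulmxBl addrC subrK.
Unshelve. all: by end_near. Qed.

End CauchyProduct.

(** * Sums of power series *)

Section PowerSeries.
Variables (R : realType) (m n : nat).

(** Ratio at most one half makes the bound independent of the number of terms
    without computing the sum. *)
Lemma sum_geo_half (q : R) J : 0 <= q -> q <= 1 / 2 -> \sum_(k < J) q ^+ k <= 2.
Proof.
move=> q0 q2; elim: J => [|J IH]; first by rewrite big_ord0.
rewrite big_ord_recl expr0; under eq_bigr do rewrite exprS.
rewrite -mulr_sumr.
have : q * (\sum_(k < J) q ^+ k) <= (1 / 2) * 2.
  by apply: ler_pM => //; apply: sumr_ge0 => k _; rewrite exprn_ge0.
lra.
Qed.

Lemma mnorm_sum (I : finType) (F : I -> 'M[R[i]]_(m, n)) :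
  mnorm (\sum_i F i) <= \sum_i mnorm (F i).
Proof.
elim/big_rec2: _ => [|i x M _ IH]; first by rewrite mnorm0.
exact: le_trans (mnormD _ _) (lerD _ _).
Qed.

(** The terms of a convergent series are bounded: all but finitely many are
    differences of two partial sums at distance less than 1 from the limit. *)
Lemma power_series_coef_bound (a : nat -> 'M[R[i]]_(m, n)) (t : R)
    (L : 'M[R[i]]_(m, n)) :
  (\sum_(1 <= k < N) (t%:C ^+ (k - 1)) *: a k) @[N --> \oo] --> L ->
  exists2 C : R, 0 <= C & forall k, `|t| ^+ k * mnorm (a k.+1) <= C.
Proof.
move=> /cvg_mnorm /(_ ltr01) [K _ KP].
set u := fun k => `|t| ^+ k * mnorm (a k.+1).
have u0 k : 0 <= u k by rewrite mulr_ge0 ?mnorm_ge0 ?exprn_ge0.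
have S0 : 0 <= \sum_(k < K) u k by exact: sumr_ge0.
exists (2 + \sum_(k < K) u k) => [|k]; first by rewrite addr_ge0.
have [kK|Kk] := ltnP k K.
  rewrite -/(u k) (bigD1 (Ordinal kK)) //= addrCA lerDl addr_ge0//.
  exact: sumr_ge0.
apply: (@le_trans _ _ 2); last by rewrite lerDl.
have := KP k.+1 (leqW Kk); have := KP k.+2 (leqW (leqW Kk)).
rewrite /= (big_nat_recr k.+1) //= subn1 /=.
move: (\sum_(1 <= i < k.+1) _) => S h2 h1.
have -> : `|t| ^+ k * mnorm (a k.+1) = mnorm (t%:C ^+ k *: a k.+1).
  by rewrite -rmorphXn mnormZ normrX.
have -> : t%:C ^+ k *: a k.+1 = (L - S) + - (L - (S + t%:C ^+ k *: a k.+1)).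
  by rewrite opprB addrC addrA subrK addrC addKr.
apply: le_trans (mnormD _ _) _; rewrite mnormN.
by rewrite (natrD _ 1 1); apply: lerD; exact: ltW.
Qed.

(** A power series is asymptotic to its partial sums: the coefficients are
    bounded by [C / t0 ^ k] at a point [t0] of convergence, so for
    [t <= t0 / 2] the tail after [N] terms is dominated by a geometric series of
    ratio at most one half, which is [O(t ^ N)]. *)
Lemma power_series_expansion (A : R -> 'M[R[i]]_(m, n))
    (a : nat -> 'M[R[i]]_(m, n)) (r : R) : 0 < r ->
  (forall t : R, 0 < t -> t < r ->
     (\sum_(1 <= k < N) (t%:C ^+ (k - 1)) *: a k) @[N --> \oo] --> A t) ->
  forall N, expansion N A (fun k => a k.+1).
Proof.
move=> r0 Aa N.
have [t0 t00 t0r] : exists2 t0 : R, 0 < t0 & t0 < r by exists (r / 2); lra.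
have [C C0 aC] := power_series_coef_bound (Aa _ t00 t0r).
rewrite gtr0_norm// in aC.
exists (C * 2 / t0 ^+ N); apply/near_right0P; exists (t0 / 2).
  by rewrite divr_gt0.
move=> t tgt0 tt0; apply/ler_addgt0Pl => e e0.
have tr : t < r by lra.
have [K _ KP] := cvg_mnorm (Aa _ tgt0 tr) e0.
have /= := KP (N + K).+1 (leqW (leq_addl _ _)).
rewrite big_add1 /= big_mkord big_split_ord /=.
under eq_bigr do rewrite subn1 /= -rmorphXn.
rewrite -/(\sum_(k < N) (t ^+ k)%:C *: a k.+1).
under [\sum_(k < K) _]eq_bigr do rewrite subn1 /= -rmorphXn.
set S := \sum_(k < N) _; set Tl := \sum_(k < K) _ => lee.
have -> : A t - S = (A t - (S + Tl)) + Tl by rewrite opprD addrA subrK.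
apply: le_trans (mnormD _ _) _; apply: lerD; first exact: ltW.
apply: le_trans (mnorm_sum _) _.
set q := t / t0.
have q0 : 0 <= q by rewrite divr_ge0 ?ltW.
have q2 : q <= 1 / 2 by rewrite /q ler_pdivrMr// ; lra.
have -> : C * 2 / t0 ^+ N * t ^+ N = C * q ^+ N * 2.
  by rewrite /q expr_div_n; move: (t0 ^+ N)^-1 (t ^+ N) => u v; ring.
apply: (@le_trans _ _ (C * q ^+ N * \sum_(k < K) q ^+ k)); last first.
  by rewrite ler_wpM2l ?sum_geo_half// mulr_ge0 ?exprn_ge0.
rewrite mulr_sumr; apply: ler_sum => k _.
rewrite mnormZ ger0_norm ?exprn_ge0 ?(ltW tgt0)// -mulrA -exprD.
have -> : t ^+ (N + k) = t0 ^+ (N + k) * q ^+ (N + k).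
  by rewrite /q expr_div_n mulrC divfK// gt_eqF ?exprn_gt0.
by rewrite mulrAC ler_wpM2r ?exprn_ge0.
Qed.

End PowerSeries.

(** * Cayley transforms *)

Section Cayley.
Variables (R : realType) (n : nat).
Implicit Types Omega Z : 'M[R[i]]_n.

(** An eigenvector for 2 would be doubled by [Omega], which is impossible if
    [Omega] is a small enough operator. *)
Lemma cayley_defined_small Omega : n%:R * mnorm Omega < 2 ->
  cayley_defined Omega.
Proof.
move=> small; apply/eigenvalueP => -[v vO v0].
have v_gt0 : 0 < mnorm v.
  rewrite lt_neqAle mnorm_ge0 andbT eq_sym.
  by apply: contra_neq v0 => /mnorm_eq0.
have := mnormM v Omega.
rewrite vO -[2](rmorph_nat (real_complex R)) mnormZ normr_nat mulrCA mulrC.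
by rewrite ler_pM2l// leNgt small.
Qed.

(** Solving [(1 - Omega / 2) Z = (1 + Omega / 2) F] for the leading [Z] removes
    the inverse, which leaves an equation suited to bootstrapping. *)
Lemma cayley_fixpoint Omega (F : 'M[R[i]]_n) : cayley_defined Omega ->
  cayley Omega *m F =
    F + (2^-1)%:C *: (Omega *m (F + cayley Omega *m F)).
Proof.
rewrite /cayley_defined /eigenvalue /eigenspace negbK kermx_eq0 row_free_unit.
move=> unitO.
have half : (2^-1)%:C = 2^-1 :> R[i] by rewrite fmorphV rmorph_nat.
have unitD : 1%:M - 2^-1 *: Omega \in unitmx.
  have -> : 1%:M - 2^-1 *: Omega = - 2^-1 *: (Omega - 2%:M).
    rewrite scalerBr scale_scalar_mx mulNr mulVf ?pnatr_eq0//.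
    by rewrite -[(-1)%:M]scalemx1 !scaleNr scale1r opprK addrC.
  by rewrite unitmxZ// unitfE oppr_eq0 invr_eq0 pnatr_eq0.
have eqZ : (1%:M - 2^-1 *: Omega) *m (cayley Omega *m F) =
           (1%:M + 2^-1 *: Omega) *m F by rewrite /cayley -mulmxA mulKVmx.
move: eqZ; rewrite mulmxBl mulmxDl !mul1mx -!scalemxAl => /eqP.
by rewrite subr_eq -addrA => /eqP {1}->; rewrite half mulmxDr scalerDr.
Qed.

Section Expansion.
Variables (Omega B F : R -> 'M[R[i]]_n) (b f z : nat -> 'M[R[i]]_n).
Hypothesis OmegaB : \forall h \near 0^'+, Omega h = h%:C *: B h.
Hypothesis Bb : forall N, expansion N B b.
Hypothesis Ff : forall N, expansion N F f.

Lemma near_mnorm_lt (e : R) : 0 < e ->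
  \forall h \near 0^'+, n%:R * mnorm (Omega h) < e.
Proof.
move=> e0; have /expansion0 [C BC] := Bb 0.
have K0 : 0 < n%:R * `|C| + 1 by rewrite ltr_wpDl ?mulr_ge0.
near=> h.
have h0 : 0 < h by near: h; exact: nbhs_right_gt.
have hK : h < e / (n%:R * `|C| + 1).
  by near: h; apply: nbhs_right_lt; rewrite divr_gt0.
have -> : Omega h = h%:C *: B h by near: h.
have BhC : mnorm (B h) <= C * h ^+ 0 by near: h.
rewrite expr0 mulr1 in BhC.
rewrite ltr_pdivlMr// mulrDr mulr1 in hK.
rewrite mnormZ gtr0_norm// mulrCA; apply: le_lt_trans hK.
apply: (@le_trans _ _ (h * (n%:R * `|C|))); last by rewrite lerDl ltW.
rewrite (ler_pM2l h0) ler_wpM2l// (le_trans BhC)// ler_norm.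
Unshelve. all: by end_near. Qed.

Lemma near_cayley_defined : \forall h \near 0^'+, cayley_defined (Omega h).
Proof.
have := near_mnorm_lt (ltr0Sn R 1); apply: filterS => h.
exact: cayley_defined_small.
Qed.

(** The start of the bootstrapping: in the fixed-point equation the unknown
    contributes at most half of its own norm, so it can be absorbed in the
    left-hand side. *)
Lemma cayley_bounded : is_bigO 0 (fun h => cayley (Omega h) *m F h).
Proof.
(* If |Z| <= |F| + (|F| + |Z|) / 2, then |Z| <= 3 |F|. *)
have /expansion0 [C FC] := Ff 0; exists (3 * C); near=> h.
have FhC : mnorm (F h) <= C by rewrite -[C]mulr1 -(expr0 h); near: h.
have def : cayley_defined (Omega h) by near: h; exact: near_cayley_defined.
have small : n%:R * mnorm (Omega h) < 1 by near: h; exact: near_mnorm_lt.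
rewrite expr0 mulr1.
have := mnormM (Omega h) (F h + cayley (Omega h) *m F h).
set Z := cayley _ *m _ in def *.
have ZE : Z = F h + (2^-1)%:C *: (Omega h *m (F h + Z)).
  exact: cayley_fixpoint.
have := mnormD (F h) ((2^-1)%:C *: (Omega h *m (F h + Z))).
rewrite -ZE mnormZ ger0_norm ?invr_ge0// mulrA.
have := mnormD (F h) Z; have := mnorm_ge0 (F h + Z).
move: (mnorm (_ *m _)) (mnorm (F h + Z)) => p s s0 le_s le_Z le_p.
have : p <= s by apply: le_trans le_p _; rewrite ler_piMl// ltW.
lra.
Unshelve. all: by end_near. Qed.

(** Coefficients that solve the formal fixed-point equation are those of the
    expansion: if they are correct up to order [N], the right-hand side of
    [cayley_fixpoint] is known up to order [N + 1] because of the factor [h] in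
    [Omega]. *)
Lemma cayley_expansion : z 0%N = f 0%N ->
  (forall k, z k.+1 = f k.+1 +
    (2^-1)%:C *: \sum_(j < k.+1) b j *m (f (k - j)%N + z (k - j)%N)) ->
  forall N, expansion N (fun h => cayley (Omega h) *m F h) z.
Proof.
move=> z0 zS; elim=> [|N IH]; first by apply/expansion0; exact: cayley_bounded.
have := expansion_mulmx (Bb N) (expansionD (Ff N) IH).
move=> /(expansionZ 2^-1) /(expansion_step 0) /(expansionD (Ff N.+1)) E.
apply: (eq_expansion _ (expansion_near _ E)).
  by case=> [_|k _]; rewrite /= ?addr0 ?z0 ?zS.
near=> h.
have OB : Omega h = h%:C *: B h by near: h.
set Z := cayley _ *m _.
have ZE : Z = F h + (2^-1)%:C *: (Omega h *m (F h + Z)).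
  by apply: cayley_fixpoint; near: h; exact: near_cayley_defined.
by rewrite [RHS]ZE OB add0r -scalemxAl !scalerA mulrC.
Unshelve. all: by end_near. Qed.

End Expansion.
End Cayley.

(** * Integration of an expansion *)

Section Integration.
Variables (R : realType) (n : nat).

(** The inequality form of differentiability: it includes [s = t], and it
    passes to the entries without any limit. *)
Lemma derivative_estimate D (Y : R -> 'M[R[i]]_n) t l (e : R) :
  has_derivative_within D Y t l -> 0 < e ->
  exists2 d : R, 0 < d & forall s, D s -> `|s - t| < d ->
    mnorm (Y s - Y t - (s - t)%:C *: l) <= e * `|s - t|.
Proof.
move=> /cvg_mnorm /[apply].
rewrite near_withinE => /nbhs_ballP [d /= d0 dP]; exists d => // s Ds std.
have [->|st] := eqVneq s t.
  by rewrite !subrr scale0r subrr mnorm0 normr0 mulr0.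
have : mnorm (l - ((s - t)^-1)%:C *: (Y s - Y t)) < e.
  by apply: dP => //; rewrite /ball /= distrC.
have st0 : s - t != 0 by rewrite subr_eq0.
have -> : l - ((s - t)^-1)%:C *: (Y s - Y t) =
          - (((s - t)^-1)%:C *: (Y s - Y t - (s - t)%:C *: l)).
  by rewrite [in RHS]scalerBr scalerA -rmorphM mulVf// scale1r opprB.
rewrite mnormN mnormZ normfV => /ltW.
by rewrite ler_pdivrMl ?normr_gt0// mulrC.
Qed.

Variable T : R.
Variables (Y G : R -> 'M[R[i]]_n).
Hypothesis T_gt0 : 0 < T.
Hypothesis Yderiv : forall t : R, t \in `[0, T[ ->
  has_derivative_within `[0, T[ Y t (G t).

(** The mean value theorem is about real functions, so it is applied to the
    real and to the imaginary part of each entry; [l] stands for either. *)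
Section RealFunctional.
Variable l : R[i] -> R.
Hypothesis lB : forall x y, l (x - y) = l x - l y.
Hypothesis lZ : forall (c : R) x, l (c%:C * x) = c * l x.
Hypothesis l_le : forall x, `|l x|%:C <= `|x|.
Variables i j : 'I_n.

Lemma functional_le (M : 'M[R[i]]_n) : `|l (M i j)| <= mnorm M.
Proof. by rewrite -lecR (le_trans (l_le _)) ?mnorm_entry. Qed.

Lemma entry_estimate t (e : R) : t \in `[0, T[ -> 0 < e ->
  exists2 d : R, 0 < d & forall s, s \in `[0, T[ -> `|s - t| < d ->
    `|l (Y s i j) - l (Y t i j) - (s - t) * l (G t i j)| <= e * `|s - t|.
Proof.
move=> tT e0; have [d d0 dP] := derivative_estimate (Yderiv tT) e0.
exists d => // s sT st; apply: le_trans (dP s sT st).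
have := functional_le (Y s - Y t - (s - t)%:C *: G t).
by rewrite !mxE lB lB lZ.
Qed.

Lemma entry_is_derive (t : R) : t \in `]0, T[ ->
  is_derive t 1 (fun s => l (Y s i j)) (l (G t i j)).
Proof.
move=> tT; have t0T : t \in `[0, T[.
  by move: tT; rewrite !in_itv /= => /andP[/ltW -> ->].
suff lim : (fun h : R => h^-1 *: (((fun s => l (Y s i j)) \o shift t) (h *: 1) -
    l (Y t i j))) @ 0^' --> l (G t i j).
  by apply: DeriveDef; [apply/cvg_ex; eexists; exact: lim | exact/cvg_lim].
apply/cvgrPdist_le => e e0; have [d d0 dP] := entry_estimate t0T e0.
move: tT; rewrite in_itv /= => /andP[t0 tT].
apply/nbhs_ballP; exists (Num.min d (Num.min t (T - t))) => /=.
  by rewrite !lt_min d0 t0 subr_gt0.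
move=> h; rewrite /ball /= sub0r normrN !lt_min => /and3P[hd ht hT] h0.
have := dP (h + t); rewrite addrK => /(_ _ hd).
have -> : h + t \in `[0, T[.
  by move: ht hT; rewrite in_itv /= !ltr_norml => /andP[? ?] /andP[? ?]; lra.
move=> /(_ isT).
rewrite /GRing.scale /= mulr1.
have -> : l (G t i j) - h^-1 * (l (Y (h + t) i j) - l (Y t i j)) =
  - (h^-1 * (l (Y (h + t) i j) - l (Y t i j) - h * l (G t i j))).
  by field.
by rewrite normrN normrM normfV ler_pdivrMl ?normr_gt0// [`|h| * e]mulrC.
Qed.

Lemma entry_cvg0 : (fun s => l (Y s i j)) @ 0^'+ --> l (Y 0 i j).
Proof.
have t0T : (0 : R) \in `[0, T[ by rewrite in_itv /= lexx.
apply/cvgrPdist_le => e e0; have [d d0 dP] := entry_estimate t0T ltr01.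
set K := `|l (G 0 i j)| + 1.
have K0 : 0 < K by rewrite ltr_wpDl.
near=> s.
have s0 : 0 < s by near: s; exact: nbhs_right_gt.
have sT : s < T by near: s; exact: nbhs_right_lt.
have sd : s < d by near: s; exact: nbhs_right_lt.
have sK : s * K <= e.
  by rewrite -ler_pdivlMr//; near: s; apply: nbhs_right_le; rewrite divr_gt0.
have := dP s; rewrite in_itv /= subr0 sT (ltW s0) gtr0_norm// => /(_ isT sd).
rewrite mul1r => le_s; rewrite distrC -(subrK (s * l (G 0 i j)) (l _ - l _)).
apply: le_trans (ler_normD _ _) _; apply: le_trans sK.
by rewrite normrM (gtr0_norm s0) /K mulrDr mulr1 addrC lerD2l.
Unshelve. all: by end_near. Qed.

(** Subtracting the integrated polynomial [p] from the entry of [Y] leaves a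
    function whose derivative is the remainder of [G], at most [C * t ^ N]; the
    mean value theorem gains the factor [h]. *)
Lemma entry_integral_bound N (g : nat -> 'M[R[i]]_n) (C d : R) : d <= T ->
  (forall t, 0 < t -> t < d ->
     mnorm (G t - \sum_(k < N) (t ^+ k)%:C *: g k) <= C * t ^+ N) ->
  forall h, 0 < h -> h < d ->
  `|l ((Y h - Y 0 -
    \sum_(k < N) (h ^+ k.+1)%:C *: ((k.+1%:R^-1)%:C *: g k)) i j)|
    <= C * h ^+ N.+1.
Proof.
move=> dT GC h h0 hd.
have l0 : l 0 = 0 by rewrite -(subrr 0) lB subrr.
have lN x : l (- x) = - l x by rewrite -sub0r lB l0 sub0r.
have lD x y : l (x + y) = l x + l y by rewrite -[y]opprK lB lN !opprK.
pose p : {poly R} := \sum_(k < N) (k.+1%:R^-1 * l (g k i j)) *: 'X^(k.+1).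
pose phi s := l (Y s i j) - p.[s].
have lsum (t : R) : l ((\sum_(k < N) (t ^+ k)%:C *: g k) i j) = p^`().[t].
  rewrite summxE /p linear_sum horner_sum.
  rewrite (big_morph l lD l0); apply: eq_bigr => k _.
  rewrite mxE lZ /= derivZ derivXn hornerZ hornerMn hornerXn.
  rewrite -[_ ^+ k *+ _]mulr_natr [RHS]mulrC -mulrA; congr (_ * _).
  by rewrite mulrA mulfV ?pnatr_eq0// mul1r.
have phiD s : s \in `]0, h[ -> is_derive s 1 phi (l (G s i j) - p^`().[s]).
  rewrite in_itv /= => /andP[s0 sh]; apply: is_deriveB.
  by apply: entry_is_derive; rewrite in_itv /= s0; lra.
have phi_cont s : s \in `]0, d[ -> {for s, continuous phi}.
  rewrite in_itv /= => /andP[s0 sd].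
  have [] : is_derive s 1 phi (l (G s i j) - p^`().[s]).
    apply: is_deriveB.
    by apply: entry_is_derive; rewrite in_itv /= s0; lra.
  by move=> /derivable1_diffP /differentiable_continuous.
have cont : {within `[0, h], continuous phi}.
  apply/continuous_within_itvP => //; split.
  - move=> s; rewrite in_itv /= => /andP[s0 sh].
    by apply: phi_cont; rewrite in_itv /= s0; lra.
  - apply: cvgB; first exact: entry_cvg0.
    by apply: cvg_at_right_filter; exact: continuous_horner.
  - by apply: cvg_at_left_filter; apply: phi_cont; rewrite in_itv /= h0.
have [c c0h] := MVT h0 phiD cont.
rewrite /phi subr0.
have -> : p.[0] = 0.
  rewrite horner_sum big1// => k _.
  by rewrite hornerZ hornerXn expr0n mulr0.
rewrite subr0 => E.
have -> : l ((Y h - Y 0 -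
    \sum_(k < N) (h ^+ k.+1)%:C *: ((k.+1%:R^-1)%:C *: g k)) i j) =
  l (Y h i j) - p.[h] - l (Y 0 i j).
  rewrite addrAC !mxE !lB summxE (big_morph l lD l0) horner_sum.
  congr (_ - _ - _); apply: eq_bigr => k _.
  by rewrite !mxE !lZ hornerZ hornerXn mulrC.
rewrite E normrM (gtr0_norm h0) exprSr mulrA ler_pM2r//.
move: c0h; rewrite in_itv /= => /andP[c0 ch].
have cd : c < d by lra.
have := GC c c0 cd.
have := functional_le (G c - \sum_(k < N) (c ^+ k)%:C *: g k).
rewrite [X in l X]mxE [X in l (_ + X)]mxE lB lsum => le1 le2.
apply: le_trans le1 _; apply: le_trans le2 _.
have C0 : 0 <= C.
  have := le_trans (mnorm_ge0 _) (GC c c0 cd).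
  by rewrite pmulr_lge0 ?exprn_gt0.
by rewrite ler_wpM2l// lerXn2r// ?nnegrE ltW.
Qed.

End RealFunctional.

(** An expansion of the derivative can be integrated term by term. *)
Lemma integral_expansion N (g : nat -> 'M[R[i]]_n) : expansion N G g ->
  expansion N.+1 Y
    (fun k => if k is k'.+1 then (k'.+1%:R^-1)%:C *: g k' else Y 0).
Proof.
move=> [C] /near_right0P[d d0 dP].
(* One C for the real parts and one for the imaginary parts. *)
exists (C + C); apply/near_right0P; exists (Num.min d T).
  by rewrite lt_min d0.
move=> h h0 hd.
have GC t : 0 < t -> t < Num.min d T ->
    mnorm (G t - \sum_(k < N) (t ^+ k)%:C *: g k) <= C * t ^+ N.
  by move=> t0; rewrite lt_min => /andP[td _]; exact: dP.
have dT : Num.min d T <= T by rewrite ge_min lexx orbT.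
have C0 : 0 <= C.
  have := le_trans (mnorm_ge0 _) (GC h h0 hd).
  by rewrite pmulr_lge0 ?exprn_gt0.
apply: mnorm_le; first by rewrite mulr_ge0 ?addr_ge0 ?exprn_ge0// ltW.
move=> i j; rewrite big_ord_recl expr0 scale1r opprD addrA.
apply: le_trans (normc_le_Re_Im _) _; rewrite lecR mulrDl; apply: lerD.
- apply: (entry_integral_bound _ _ _ _ _ dT GC h0 hd)
    => [[? ?] [? ?]|? [? ?]|x] //.
    by rewrite /= mul0r subr0.
  exact: normc_ge_Re.
- apply: (entry_integral_bound _ _ _ _ _ dT GC h0 hd)
    => [[? ?] [? ?]|? [? ?]|x] //.
    by rewrite /= mul0r addr0.
  exact: normc_ge_Im.
Qed.

End Integration.

(** * Sums over words *)

Section WordSums.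
Variables (R : realType) (n : nat).
Variables (b : nat -> 'M[R[i]]_n) (M0 : 'M[R[i]]_n).
Implicit Types (c d : seq nat -> R) (w : seq nat).

(** The letter [j] stands for [b j], the coefficient of [t ^ j] in [A]; every
    factor [A] comes with one integration or one factor [h], so that the letter
    contributes [h ^ (j + 1)]. *)
Definition weight w : nat := \sum_(j <- w) j.+1.

(** The sum of [c(j1 ... jr) b j1 * ... * b jr * M0] over the words of weight
    [k], by choice of the first letter. The recursion goes from [k + 1] to all
    smaller values, hence the extra argument; any [fuel >= k] gives the same
    result. *)
Fixpoint word_sum_rec fuel k c : 'M[R[i]]_n :=
  match fuel, k with
  | fuel'.+1, k'.+1 =>
    \sum_(j < k'.+1)
      b j *m word_sum_rec fuel' (k' - j)%N (fun w => c ((j : nat) :: w))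
  | _, _ => (c [::])%:C *: M0
  end.

Definition word_sum k c := word_sum_rec k k c.

Lemma word_sum_rec_fuel fuel k c : (k <= fuel)%N ->
  word_sum_rec fuel k c = word_sum k c.
Proof.
rewrite /word_sum; elim/ltn_ind: k fuel c => -[|k] IH [|fuel] c //= kf.
apply: eq_bigr => j _; congr (_ *m _).
have kj : (k - j < k.+1)%N by rewrite ltnS leq_subr.
rewrite (IH _ kj) ?(IH _ kj k) ?leq_subr//.
by apply: leq_trans (leq_subr _ _) _; rewrite -ltnS.
Qed.

Lemma word_sum0 c : word_sum 0 c = (c [::])%:C *: M0.
Proof. by []. Qed.

Lemma word_sumS k c : word_sum k.+1 c =
  \sum_(j < k.+1) b j *m word_sum (k - j)%N (fun w => c ((j : nat) :: w)).
Proof.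
rewrite /word_sum /=; apply: eq_bigr => j _; congr (_ *m _).
by rewrite word_sum_rec_fuel// leq_subr.
Qed.

Lemma eq_word_sum k c d : (forall w, weight w = k -> c w = d w) ->
  word_sum k c = word_sum k d.
Proof.
elim/ltn_ind: k c d => -[|k] IH c d cd.
  by rewrite !word_sum0 cd// /weight big_nil.
rewrite !word_sumS; apply: eq_bigr => j _; congr (_ *m _).
apply: IH => [|w wk]; first by rewrite ltnS leq_subr.
by apply: cd; rewrite /weight big_cons -/(weight w) wk addSn subnKC// -ltnS.
Qed.

Lemma word_sumD k c d :
  word_sum k (fun w => c w + d w) = word_sum k c + word_sum k d.
Proof.
elim/ltn_ind: k c d => -[|k] IH c d.
  by rewrite !word_sum0 rmorphD scalerDl.
rewrite !word_sumS -big_split; apply: eq_bigr => j _ /=.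
by rewrite IH ?ltnS ?leq_subr// mulmxDr.
Qed.

Lemma word_sumZ k (x : R) c :
  word_sum k (fun w => x * c w) = x%:C *: word_sum k c.
Proof.
elim/ltn_ind: k c => -[|k] IH c; first by rewrite !word_sum0 rmorphM scalerA.
rewrite !word_sumS scaler_sumr; apply: eq_bigr => j _ /=.
by rewrite IH ?ltnS ?leq_subr// scalemxAr.
Qed.

Definition unit_word w : R := (w == [::])%:R.

Lemma word_sum_unit k : word_sum k unit_word = if k is 0%N then M0 else 0.
Proof.
case: k => [|k]; first by rewrite word_sum0 scale1r.
rewrite word_sumS big1// => j _.
rewrite [word_sum _ _](@eq_word_sum _ _ (fun w => 0 * unit_word w)).
  by rewrite word_sumZ scale0r mulmx0.
by move=> w _; rewrite mul0r.
Qed.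

(** The coefficient of a word in the solution of [Y' = A Y]: iterated integrals
    of powers of [t] give the product of the inverse weights of its nonempty
    suffixes. *)
Fixpoint flow_word w : R :=
  if w is j :: w' then (weight w)%:R^-1 * flow_word w' else 1.

Lemma word_sum_flow k : word_sum k.+1 flow_word =
  (k.+1%:R^-1)%:C *: \sum_(j < k.+1) b j *m word_sum (k - j)%N flow_word.
Proof.
rewrite word_sumS scaler_sumr; apply: eq_bigr => j _.
rewrite scalemxAr -word_sumZ; congr (_ *m _); apply: eq_word_sum => w wk /=.
by rewrite /weight big_cons -/(weight w) wk addSn subnKC// -ltnS.
Qed.

(** The action on coefficients of [F |-> Z = Cay(h B) F], read off from
    [Z = F + h B (F + Z) / 2] when [B] has the coefficients [u j * b j]. *)
Fixpoint cayley_word (u : nat -> R) c w : R :=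
  if w is j :: w' then c w + 2^-1 * (u j * (c w' + cayley_word u c w'))
  else c [::].

Lemma word_sum_cayley u c k :
  word_sum k.+1 (cayley_word u c) = word_sum k.+1 c + (2^-1)%:C *:
    \sum_(j < k.+1) ((u j)%:C *: b j) *m
      (word_sum (k - j)%N c + word_sum (k - j)%N (cayley_word u c)).
Proof.
rewrite !word_sumS scaler_sumr -big_split; apply: eq_bigr => j _ /=.
rewrite -word_sumD -scalemxAl scalemxAr -word_sumZ scalemxAr -word_sumZ.
by rewrite -mulmxDr -word_sumD.
Qed.

End WordSums.

(** * The order conditions *)

Section OrderConditions.
Variable R : realType.

(** With [c] the cube root of 2, [alpha11 = 1 / (2 - c)]: the cubic is
    [c ^ 3 = 2] in terms of [alpha11]. *)
Lemma alpha11_cubic : alpha11 R * (1 - alpha11 R) ^+ 2 = 1 / 6.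
Proof.
have c3 : (2 : R) `^ (1 / 3) ^+ 3 = 2.
  by rewrite -powR_mulrn ?powR_ge0// -powRrM div1r mulVf ?powRr1 ?pnatr_eq0.
have c2 : (2 : R) `^ (2 / 3) = 2 `^ (1 / 3) ^+ 2.
  by rewrite -powR_mulrn ?powR_ge0// -powRrM; congr (_ `^ _); field.
rewrite /alpha11 c2; move: (2 `^ (1 / 3)) c3 => c c3.
have c4 : c ^+ 4 = 2 * c by rewrite exprSr c3.
have c5 : c ^+ 5 = 2 * c ^+ 2 by rewrite -[5%N]/(3 + 2)%N exprD c3.
have c6 : c ^+ 6 = 4 by rewrite -[6%N]/(3 * 2)%N exprM c3; ring.
lra.
Qed.

(** The exponents combine [A] at the nodes [c1] and [c2] through the mean
    [(A(c1 h) + A(c2 h)) / 2] and the slope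
    [sqrt 3 / 2 * (A(c2 h) - A(c1 h))]; these are the factors of [h ^ j * b j]
    in the two. *)
Definition node_mean j : R :=
  ((1 / 2 - Num.sqrt 3 / 6) ^+ j + (1 / 2 + Num.sqrt 3 / 6) ^+ j) / 2.
Definition node_slope j : R :=
  Num.sqrt 3 / 2 *
  ((1 / 2 + Num.sqrt 3 / 6) ^+ j - (1 / 2 - Num.sqrt 3 / 6) ^+ j).

Lemma sqr_sqrt3 : Num.sqrt (3 : R) ^+ 2 = 3.
Proof. by rewrite sqr_sqrtr. Qed.

(** The two-point Gauss-Legendre rule is exact for cubic polynomials: these are
    the integrals of [t ^ j] over [[0, 1]]. *)
Lemma node_meanE : [/\ node_mean 0 = 1, node_mean 1 = 1 / 2,
  node_mean 2 = 1 / 3 & node_mean 3 = 1 / 4].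
Proof.
rewrite /node_mean; have := sqr_sqrt3; move: (Num.sqrt 3) => s s2.
by split; lra.
Qed.

Lemma node_slopeE : [/\ node_slope 0 = 0, node_slope 1 = 1 / 2 &
  node_slope 2 = 1 / 2].
Proof.
rewrite /node_slope; have := sqr_sqrt3; move: (Num.sqrt 3) => s s2.
by split; lra.
Qed.

Definition exponent_coef (x y : R) j := x * node_mean j + y * node_slope j.

(** Sixteen words have weight at most 4, one for each composition of
    0, ..., 4. After substitution of the moments each condition is a polynomial
    identity of degree at most 4 in [x = alpha11], linear in [x] and [x ^ 2]
    once the cubic has been used to reduce [x ^ 3] and [x ^ 4]. *)
Lemma order_conditions w : (weight w < 5)%N ->
  cayley_word (exponent_coef (alpha11 R) (alpha12 R))
    (cayley_word (exponent_coef (alpha21 R) 0)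
      (cayley_word (exponent_coef (alpha11 R) (- alpha12 R)) (@unit_word R))) w
  = flow_word R w.
Proof.
have [m0 m1 m2 m3] := node_meanE; have [s0 s1 s2] := node_slopeE.
have := alpha11_cubic.
rewrite /exponent_coef /alpha12 /alpha21.
move: (alpha11 R) => x cubic.
have x3 : x ^+ 3 = 2 * x ^+ 2 - x + 1 / 6 by lra.
have x4 : x ^+ 4 = 3 * x ^+ 2 - 11 / 6 * x + 1 / 3.
  by rewrite exprSr x3; lra.
have weight_cons j v : weight (j :: v) = (j + weight v).+1.
  by rewrite /weight big_cons addSn.
have weight_nil : weight [::] = 0%N by rewrite /weight big_nil.
have weightE := (weight_cons, weight_nil).
have momentE := (addSn, add0n, m0, m1, m2, m3, s0, s1, s2).
(* The letters of a word of length r and weight at most 4 are at most 4 - r. *)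
case: w => [|j1 [|j2 [|j3 [|j4 [|j5 w]]]]]; rewrite !weightE.
- by [].
- case: j1 => [|[|[|[|j1]]]] wk; try (exfalso; lia);
  rewrite /= /unit_word /= ?weightE !momentE; lra.
- move: j1 j2 => [|[|[|j1]]] [|[|[|j2]]] wk; try (exfalso; lia);
  rewrite /= /unit_word /= ?weightE !momentE; lra.
- move: j1 j2 j3 => [|[|j1]] [|[|j2]] [|[|j3]] wk; try (exfalso; lia);
  rewrite /= /unit_word /= ?weightE !momentE; lra.
- move: j1 j2 j3 j4 => [|j1] [|j2] [|j3] [|j4] wk; try (exfalso; lia);
  rewrite /= /unit_word /= ?weightE !momentE; lra.
- lia.
Qed.

End OrderConditions.

(** * Expansions of the scheme and of the flow *)

Section Magnus.
Variables (R : realType) (n : nat) (A : R -> 'M[R[i]]_n).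
Variable b : nat -> 'M[R[i]]_n.
Hypothesis Ab : forall N, expansion N A b.

(** The exponent of a factor divided by the step, for coefficients [x] and [y]
    of the two moments. *)
Definition node_combination (x y h : R) : 'M[R[i]]_n :=
  (x / 2)%:C *: (gauss_node1 A h + gauss_node2 A h) +
  (y * Num.sqrt 3 / 2)%:C *: (gauss_node2 A h - gauss_node1 A h).

Lemma magnus_combination (x y h : R) :
  x%:C *: magnus1 A h + y%:C *: magnus2 A h =
    h%:C *: node_combination x y h.
Proof.
rewrite scalerDr !scalerA -!rmorphM /=.
by congr (_%:C *: _ + _%:C *: _); ring.
Qed.

Lemma sqrt3_lt3 : Num.sqrt (3 : R) < 3.
Proof.
have s0 := sqrtr_ge0 (3 : R); have := sqr_sqrt3 R; nra.
Qed.

Lemma node_combination_expansion (x y : R) N :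
  expansion N (node_combination x y)
    (fun j => (exponent_coef x y j)%:C *: b j).
Proof.
have s3 := sqrt3_lt3; have s0 := sqrtr_ge0 (3 : R).
have c1 : 0 < 1 / 2 - Num.sqrt (3 : R) / 6 by lra.
have c2 : 0 < 1 / 2 + Num.sqrt (3 : R) / 6 by lra.
have E1 := expansion_rescale c1 (Ab N); have E2 := expansion_rescale c2 (Ab N).
have Em := expansionZ (x / 2) (expansionD E1 E2).
have Es := expansionZ (y * Num.sqrt 3 / 2) (expansionD E2 (expansionZ (-1) E1)).
apply: (eq_expansion _ (expansion_near _ (expansionD Em Es))) => [k _|].
  rewrite !scalerDr !scalerA -!rmorphM -!scalerDl -!rmorphD /=.
  by congr (_%:C *: _); rewrite /exponent_coef /node_mean /node_slope; field.
apply: nearW => h; rewrite /node_combination /gauss_node1 /gauss_node2.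
by rewrite rmorphN1 scaleN1r.
Qed.

End Magnus.

Section Flow.
Variables (R : realType) (n : nat) (T : R) (Y A : R -> 'M[R[i]]_n).
Variable b : nat -> 'M[R[i]]_n.
Hypothesis T_gt0 : 0 < T.
Hypothesis Ab : forall N, expansion N A b.
Hypothesis Yode : forall t : R, t \in `[0, T[ ->
  has_derivative_within `[0, T[ Y t (A t *m Y t).

(** Differentiability at 0 gives the bound that starts the bootstrapping. *)
Lemma flow_bounded : is_bigO 0 Y.
Proof.
have t0T : (0 : R) \in `[0, T[ by rewrite in_itv /= lexx.
have [d d0 dP] := derivative_estimate (Yode t0T) ltr01.
exists (mnorm (Y 0) + mnorm (A 0 *m Y 0) + 1).
near=> h; rewrite expr0 mulr1.
have h0 : 0 < h by near: h; exact: nbhs_right_gt.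
have hT : h < T by near: h; exact: nbhs_right_lt.
have hd : h < d by near: h; exact: nbhs_right_lt.
have h1 : h < 1 by near: h; exact: nbhs_right_lt.
have := dP h; rewrite /= in_itv /= (ltW h0) hT subr0 gtr0_norm// mul1r.
move=> /(_ isT hd); set M := A 0 *m Y 0 => le_h.
have -> : Y h = (Y 0 + h%:C *: M) + (Y h - Y 0 - h%:C *: M).
  by rewrite -[Y h - _ - _]addrA -opprD [RHS]addrC subrK.
apply: le_trans (mnormD _ _) _; apply: lerD; last first.
  by rewrite (le_trans le_h) ?ltW.
apply: le_trans (mnormD _ _) _; rewrite lerD2l mnormZ gtr0_norm//.
by rewrite ler_piMl ?mnorm_ge0// ltW.
Unshelve. all: by end_near. Qed.

Lemma flow_expansion N :
  expansion N Y (fun k => word_sum b (Y 0) k (@flow_word R)).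
Proof.
elim: N => [|N IH]; first by apply/expansion0; exact: flow_bounded.
have := integral_expansion T_gt0 Yode (expansion_mulmx (Ab N) IH).
apply: eq_expansion => -[|k] _; first by rewrite word_sum0 scale1r.
by rewrite word_sum_flow.
Qed.

End Flow.

Lemma constant_expansion (R : realType) n (b : nat -> 'M[R[i]]_n)
    (M0 : 'M[R[i]]_n) N :
  expansion N (fun=> M0) (fun k => word_sum b M0 k (@unit_word R)).
Proof.
case: N => [|N].
  apply/expansion0; exists (mnorm M0).
  by apply: nearW => h; rewrite expr0 mulr1.
apply: is_bigO_near (is_bigO0 _ _ _ _); apply: nearW => h.
rewrite big_ord_recl expr0 scale1r word_sum_unit big1 ?addr0 ?subrr// => k _.
by rewrite word_sum_unit scaler0.
Qed.

Lemma cayley_word_expansion (R : realType) n (b : nat -> 'M[R[i]]_n)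
    (M0 : 'M[R[i]]_n) (Omega B F : R -> 'M[R[i]]_n) (u : nat -> R) c :
  (forall h, Omega h = h%:C *: B h) ->
  (forall N, expansion N B (fun j => (u j)%:C *: b j)) ->
  (forall N, expansion N F (fun k => word_sum b M0 k c)) ->
  forall N, expansion N (fun h => cayley (Omega h) *m F h)
    (fun k => word_sum b M0 k (cayley_word u c)).
Proof.
move=> OB Bb Fc; apply: (cayley_expansion (nearW _ OB) Bb Fc) => [//|k].
exact: word_sum_cayley.
Qed.

Theorem proposition3p2 (R : realType) (n : nat) (J : 'M[R[i]]_n)
    (hJ : J \in unitmx)
    (T : R) (hT : 0 < T)
    (A : R -> 'M[R[i]]_n)
    (hA : forall t : R, t \in `[0, T[ -> quadratic_algebra J (A t))
    (a : nat -> 'M[R[i]]_n)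
    (hAexp : exists2 r : R, 0 < r & forall t : R, t \in `[0, T[ -> t < r ->
       (\sum_(1 <= m < N) (t%:C ^+ (m - 1)) *: a m) @[N --> \oo] --> A t)
    (Y0 : 'M[R[i]]_n) (hY0 : quadratic_group J Y0)
    (Y : R -> 'M[R[i]]_n)
    (hYinit : Y 0 = Y0)
    (hYode : forall t : R, t \in `[0, T[ ->
       has_derivative_within `[0, T[ Y t (A t *m Y t)) :
  (\forall dt \near (0 : R)^'+,
     [/\ cayley_defined (exponent_left A dt),
         cayley_defined (exponent_middle A dt) &
         cayley_defined (exponent_right A dt)]) /\
  Y = (fun dt : R => cayley (exponent_left A dt) *m
                     cayley (exponent_middle A dt) *m
                     cayley (exponent_right A dt) *m Y0)
      +O_ ((0 : R)^'+) (fun dt : R => (dt ^+ 5)%:C).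
Proof.
have [r r0 Aa] := hAexp.
have Ab : forall N, expansion N A (fun k => a k.+1).
  apply: (@power_series_expansion _ _ _ A a (Num.min r T)).
    by rewrite lt_min r0.
  move=> t t0; rewrite lt_min => /andP[tr tT].
  by apply: Aa; rewrite ?in_itv /= ?(ltW t0).
have leftE h : exponent_left A h =
    h%:C *: node_combination A (alpha11 R) (alpha12 R) h.
  exact: magnus_combination.
have middleE h : exponent_middle A h =
    h%:C *: node_combination A (alpha21 R) 0 h.
  by rewrite -magnus_combination scale0r addr0.
have rightE h : exponent_right A h =
    h%:C *: node_combination A (alpha11 R) (- alpha12 R) h.
  by rewrite -magnus_combination rmorphN scaleNr.
have Bb x y N := node_combination_expansion Ab x y N.
split.
  have defined_near (Omega B : R -> 'M[R[i]]_n) b :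
      (forall h, Omega h = h%:C *: B h) -> (forall N, expansion N B b) ->
      \forall h \near (0 : R)^'+, cayley_defined (Omega h).
    by move=> OB EB; apply: near_cayley_defined EB; exact: nearW.
  have D1 := defined_near _ _ _ leftE (Bb _ _).
  have D2 := defined_near _ _ _ middleE (Bb _ _).
  have D3 := defined_near _ _ _ rightE (Bb _ _).
  by apply: filterS3 D1 D2 D3 => h.
have Z1 := cayley_word_expansion rightE (Bb _ _)
  (constant_expansion (fun k => a k.+1) Y0).
have Z2 := cayley_word_expansion middleE (Bb _ _) Z1.
have Z3 := cayley_word_expansion leftE (Bb _ _) Z2.
have Yw := flow_expansion hT Ab hYode 5.
rewrite hYinit in Yw.
have := expansion_sub Yw (eq_expansion _ (Z3 5%N)).
case=> [k k5|C YC].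
  by apply: eq_word_sum => w wk; apply: order_conditions; rewrite wk.
apply/eqaddOP; near=> K; near=> h.
have YhC : mnorm (Y h - cayley (exponent_left A h) *m
    (cayley (exponent_middle A h) *m (cayley (exponent_right A h) *m Y0))) <=
    C * h ^+ 5 by near: h.
have h0 : 0 < h by near: h; exact: nbhs_right_gt.
have CK : C%:C <= K by near: K; apply: nbhs_pinfty_ge; rewrite complex_real.
rewrite -![(_ - _) h]/(_ - _) -2!mulmxA.
rewrite norm_real_complex gtr0_norm ?exprn_gt0// -mnormE.
apply: (@le_trans _ _ (C * h ^+ 5)%:C); first by rewrite lecR.
by rewrite rmorphM ler_wpM2r// ler0c exprn_ge0// ltW.
Unshelve. all: by end_near. Qed.
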